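(* Let $X$ be a compact Hausdorff space. Then: (a) $ker(X)$ is a closed subset of $X$; (b) if $Y$ is any closed subset of $X$, then $ker(Y) \subseteq ker(X)$; (c) $X \in MS$ iff $ker(X) = \emptyset$; (d) $ker(ker(X)) = ker(X)$.
   Context: All spaces are Hausdorff. $MS$ is the class of compact Hausdorff spaces $X$ such that every Radon measure (finite regular Borel measure) on $X$ is separable, where a measure is separable iff its measure algebra (Borel sets modulo null sets, with metric $d(A,B)=\mu(A\triangle B)$) is separable as a metric space. For compact $X$, $ker(X) = X \setminus \bigcup\{U \subseteq X : U \text{ open and } \mathrm{cl}(U) \in MS\}$, where $\mathrm{cl}$ is topological closure in $X$. *)

(* Defs.v *)
From HB Require Import structures.
From mathcomp Require Import all_boot all_order all_algebra generic_quotient.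
From mathcomp Require Import all_classical all_reals all_analysis.

Set Implicit Arguments.
Unset Strict Implicit.
Unset Printing Implicit Defensive.

Import Order.TTheory GRing.Theory Num.Theory.

Local Open Scope classical_set_scope.
Local Open Scope ring_scope.

Definition separable (T : topologicalType) : Prop :=
  exists2 D : set T, countable D & dense D.

Section MeasureAlgebra.
Context d (T : measurableType d) (R : realType).
Variable mu : {finite_measure set T -> \bar R}.

Local Notation measurable_set := (set_type (@measurable d T)).

Implicit Types A B C : measurable_set.

Lemma measurable_setP A : measurable (\val A).
Proof. by case: A => A /= /set_mem. Qed.

(* [fine] loses nothing here since [mu] is finite. *)
Definition symdiff_dist A B : R := fine (mu (\val A `+` \val B)).

Lemma measurable_symdiff A B : measurable (\val A `+` \val B).
Proof.
by rewrite setY_def; apply: measurableU; apply: measurableD;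
  exact: measurable_setP.
Qed.

Lemma symdiff_dist_ge0 A B : 0 <= symdiff_dist A B.
Proof. exact: fine_ge0. Qed.

Lemma symdiff_distxx A : symdiff_dist A A = 0.
Proof. by rewrite /symdiff_dist setYK measure0. Qed.

Lemma symdiff_dist_sym A B : symdiff_dist A B = symdiff_dist B A.
Proof. by rewrite /symdiff_dist setYC. Qed.

Lemma symdiff_dist_triangle B A C :
  symdiff_dist A C <= symdiff_dist A B + symdiff_dist B C.
Proof.
rewrite -fineD ?fin_num_measure//; try exact: measurable_symdiff.
apply: fine_le.
- by rewrite fin_num_measure//; exact: measurable_symdiff.
- by rewrite fin_numD !fin_num_measure//; exact: measurable_symdiff.
apply: (@le_trans _ _ (mu ((\val A `+` \val B) `|` (\val B `+` \val C)))).
  apply: le_measure; rewrite ?inE.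
  - exact: measurable_symdiff.
  - by apply: measurableU; exact: measurable_symdiff.
  move=> x; rewrite !setY_def /setD /setU /=.
  by case: (pselect ((\val B) x)) => ?; tauto.
by apply: measureU2; exact: measurable_symdiff.
Qed.

Definition null_symdiff A B : bool := symdiff_dist A B == 0.

Lemma null_symdiff_refl : reflexive null_symdiff.
Proof. by move=> A; rewrite /null_symdiff symdiff_distxx. Qed.

Lemma null_symdiff_sym : symmetric null_symdiff.
Proof. by move=> A B; rewrite /null_symdiff symdiff_dist_sym. Qed.

Lemma null_symdiff_trans : transitive null_symdiff.
Proof.
move=> B A C /eqP AB /eqP BC; rewrite /null_symdiff eq_le symdiff_dist_ge0 andbT.
by rewrite (le_trans (symdiff_dist_triangle B A C))// AB BC addr0.
Qed.

Canonical null_symdiff_equiv :=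
  EquivRel null_symdiff null_symdiff_refl null_symdiff_sym null_symdiff_trans.

Definition measure_algebra : Type := {eq_quot null_symdiff}%qT.
HB.instance Definition _ := Choice.on measure_algebra.

Definition measure_class A : measure_algebra :=
  \pi_({eq_quot null_symdiff})%qT A.

(* Well defined on classes: see [measure_algebra_distE]. *)
Definition measure_algebra_dist (a b : measure_algebra) : R :=
  symdiff_dist (repr a) (repr b).

Lemma measure_algebra_distE A B :
  measure_algebra_dist (measure_class A)
    (measure_class B) = symdiff_dist A B.
Proof.
rewrite /measure_algebra_dist.
have H C : symdiff_dist (repr (measure_class C)) C = 0.
  apply/eqP; rewrite -/(null_symdiff _ _).
  by rewrite -(eqmodE null_symdiff_equiv) reprK.
apply/eqP; rewrite eq_le; apply/andP; split.
  apply: (le_trans (symdiff_dist_triangle A _ _)).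
  by rewrite H add0r (le_trans (symdiff_dist_triangle B _ _))//
    (symdiff_dist_sym B) H addr0.
apply: (le_trans (symdiff_dist_triangle
  (repr (measure_class A)) _ _)).
rewrite (symdiff_dist_sym A) H add0r.
by rewrite (le_trans (symdiff_dist_triangle
  (repr (measure_class B)) _ _))// H addr0.
Qed.

Lemma measure_algebra_distxx a : measure_algebra_dist a a = 0.
Proof. exact: symdiff_distxx. Qed.

Lemma measure_algebra_dist0 a b : measure_algebra_dist a b = 0 -> a = b.
Proof.
move=> /eqP ab; rewrite -[a]reprK -[b]reprK; apply/eqP.
by rewrite (eqmodE null_symdiff_equiv).
Qed.

Lemma measure_algebra_dist_sym a b :
  measure_algebra_dist a b = measure_algebra_dist b a.
Proof. exact: symdiff_dist_sym. Qed.

Lemma measure_algebra_dist_triangle b a c : measure_algebra_dist a c <=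
  measure_algebra_dist a b + measure_algebra_dist b c.
Proof. exact: symdiff_dist_triangle. Qed.

HB.instance Definition _ := isMetric.Build R measure_algebra
  measure_algebra_distxx measure_algebra_dist0 measure_algebra_dist_sym
  measure_algebra_dist_triangle.

Definition separable_measure : Prop := separable measure_algebra.

End MeasureAlgebra.

Definition borel (T : ptopologicalType) : Type :=
  g_sigma_algebraType (@open T).
HB.instance Definition _ (T : ptopologicalType) :=
  Measurable.on (borel T).

Definition regular_measure (T : ptopologicalType) (R : realType)
    (mu : {finite_measure set (borel T) -> \bar R}) : Prop :=
  forall B : set T, measurable (B : set (borel T)) ->
    mu B = ereal_sup [set mu K | K in [set K : set T | compact K /\ K `<=` B]]
    /\
    mu B = ereal_inf [set mu U | U in [set U : set T | open U /\ B `<=` U]].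

(* Measurable types are pointed in the library whereas closed subspaces may be
   empty, hence this copy of [T] with a designated point. *)
Definition pointed_at (T : topologicalType) (x : T) : Type := T.
HB.instance Definition _ (T : topologicalType) (x : T) :=
  Topological.on (@pointed_at T x).
HB.instance Definition _ (T : topologicalType) (x : T) :=
  isPointed.Build (@pointed_at T x) x.

(* The point [x] plays no role besides asserting that [X] is nonempty: the empty
   space is in the class, its only measure being zero. *)
Definition MS (R : realType) (X : topologicalType) : Prop :=
  [/\ compact [set: X], hausdorff_space X &
    forall (x : X) (mu : {finite_measure set (borel (pointed_at x)) -> \bar R}),
      regular_measure mu -> separable_measure mu].

(* Subsets of [X] are coerced to [set_type], which carries the subspace
   topology. *)
Definition ker (R : realType) (X : topologicalType) : set X :=
  ~` \bigcup_(U in [set U : set X | open U /\ MS R (closure U)]) U.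
Arguments ker R X : clear implicits.

(* Main.v *)
(** Everything is read off measures on the ambient space [X].  Call a Borel set
    [Z] separable for [mu] when countably many Borel sets approximate every Borel
    set up to a small [mu]-measure inside [Z].  This is hereditary, stable under
    finite unions, local on compact sets, and passes to [Z] when it holds for
    subsets of [Z] of measure arbitrarily close to that of [Z].  Restricting and
    pushing forward regular measures along an embedding of a compact space shows
    that a closed [Z] is in [MS] iff it is separable for every regular measure on
    [X].  Then (c) is the passage from local to global.  For (d), if [V] is a
    neighbourhood of [x] whose trace on [ker X] has closure in [MS], let [W] be a
    neighbourhood of [x] with [closure W] inside [V]: [closure W] meets [ker X] in
    a set in [MS], and the complement of [ker X] is exhausted, up to small measure,
    by compact sets, which are covered by finitely many open sets with closure in
    [MS]; so [closure W] is in [MS] and [x] is not in [ker X]. *)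

Require Import Defs.
From HB Require Import structures.
From mathcomp Require Import all_boot all_order all_algebra.
From mathcomp Require Import all_classical all_reals all_analysis.

Set Implicit Arguments.
Unset Strict Implicit.
Unset Printing Implicit Defensive.

Import Order.TTheory GRing.Theory Num.Theory.

Local Open Scope classical_set_scope.
Local Open Scope ring_scope.

(** * Separability of a finite measure relative to a measurable set *)

Section SeparableOn.
Local Open Scope ereal_scope.
Context d (T : measurableType d) (R : realType).
Variable mu : {finite_measure set T -> \bar R}.
Implicit Types (A B Z : set T) (e : R).

(** The approximating sets need not lie in [Z]; only errors inside [Z] count. The same family
    therefore serves every measurable subset of [Z], and all sets stay in one ambient space. *)
Definition separable_on Z : Prop :=
  exists D : set (set T), [/\ countable D, D `<=` measurable &
    forall A e, measurable A -> (0 < e)%R ->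
      exists2 B, D B & mu ((A `+` B) `&` Z) < e%:E].

Lemma measurableY A B : measurable A -> measurable B -> measurable (A `+` B).
Proof.
by move=> mA mB; rewrite setY_def; apply: measurableU; exact: measurableD.
Qed.

Lemma le_measure_setI A Z Y : measurable A -> measurable Z -> measurable Y ->
  Z `<=` Y -> mu (A `&` Z) <= mu (A `&` Y).
Proof.
move=> mA mZ mY ZY; apply: le_measure; rewrite ?inE; try exact: measurableI.
exact: setIS.
Qed.

Lemma separable_measureP : separable_measure mu <-> separable_on setT.
Proof.
have distE A B (mA : A \in measurable) (mB : B \in measurable) :
    (measure_algebra_dist (measure_class mu (exist _ A mA))
      (measure_class mu (exist _ B mB)))%:E = mu (A `+` B).
  rewrite measure_algebra_distE fineK//=.
  by apply: fin_num_measure; apply: measurableY; exact: set_mem.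
split=> [[D cD dD]|[D [cD mD dD]]].
  exists ((fun a : measure_algebra mu => \val (repr a)) @` D); split.
  - exact: card_le_trans (card_image_le _ _) cD.
  - by move=> _ [a _ <-]; exact: measurable_setP.
  move=> A e mA e0; set a := measure_class mu (exist _ A (mem_set mA)).
  have [|b [bae Db]] := dD ((ball a e)°) _ (open_interior _).
    by exists a; exact: nbhsx_ballx.
  exists (\val (repr b)); first by exists b.
  rewrite setIT; move/interior_subset : bae.
  rewrite ballEmdist /= -lte_fin -[b in X in X -> _]reprK.
  by case: (repr b) => B mB; rewrite -(distE _ _ (mem_set mA) mB).
(* The class of [setT] is a default for nonmeasurable [B]; it is never reached on [D]. *)
pose g B := if pselect (measurable B) is left mB
  then measure_class mu (exist _ B (mem_set mB))
  else measure_class mu (exist _ setT (mem_set measurableT)).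
exists (g @` D); first exact: card_le_trans (card_image_le _ _) cD.
move=> O [a Oa] oO; have /nbhs_ballP[e /= e0 aeO] := open_nbhs_nbhs (conj oO Oa).
have [B DB aB] := dD _ _ (measurable_setP (repr a)) e0.
exists (g B); split; last by exists B.
apply: aeO; rewrite ballEmdist /=; rewrite -lte_fin; move: aB.
rewrite setIT -{2}[a]reprK /g; case: pselect => [mB|]; last by move: (mD _ DB).
by case: (repr a) => A mA; rewrite -(distE _ _ mA (mem_set mB)).
Qed.

Lemma separable_onS Z Y : measurable Z -> measurable Y -> Z `<=` Y ->
  separable_on Y -> separable_on Z.
Proof.
move=> mZ mY ZY [D [cD mD dD]]; exists D; split=> // A e mA e0.
have [B DB BA] := dD A e mA e0; exists B => //.
apply: le_lt_trans BA; apply: le_measure_setI => //.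
by apply: measurableY => //; exact: mD.
Qed.

Lemma separable_on0 : separable_on set0.
Proof.
exists [set set0]; split; first exact: countable1.
  by move=> _ ->.
by move=> A e mA e0; exists set0 => //; rewrite setI0 measure0 lte_fin.
Qed.

Lemma separable_onU Z Y : measurable Z -> measurable Y ->
  separable_on Z -> separable_on Y -> separable_on (Z `|` Y).
Proof.
move=> mZ mY [D [cD mD dD]] [E [cE mE dE]].
(* Follow the first set on [Z] and the second off [Z]: the error in the union is then covered by the
   error of [p.1] in [Z] and that of [p.2] in [Y]. *)
pose glue (p : set T * set T) := (p.1 `&` Z) `|` (p.2 `\` Z).
have mglue p : D p.1 -> E p.2 -> measurable (glue p).
  by move=> /mD mp1 /mE mp2; apply: measurableU;
    [exact: measurableI|exact: measurableD].
exists (glue @` (D `*` E)); split.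
- apply: card_le_trans (card_image_le _ _) _; exact: countableX.
- by move=> _ [p [] /[swap] ? /mglue + <-]; exact.
move=> A e mA e0; have e20 : (0 < e / 2)%R by rewrite divr_gt0.
have [B DB AB] := dD A _ mA e20; have [C EC AC] := dE A _ mA e20.
exists (glue (B, C)); first by exists (B, C).
have mAB : measurable (A `+` B) by apply: measurableY => //; exact: mD.
have mAC : measurable (A `+` C) by apply: measurableY => //; exact: mE.
rewrite (splitr e) EFinD; apply: le_lt_trans (lteD AB AC).
apply: (@le_trans _ _ (mu (((A `+` B) `&` Z) `|` ((A `+` C) `&` Y)))); last first.
  by apply: measureU2; exact: measurableI.
apply: le_measure; rewrite ?inE.
- apply: measurableI; last exact: measurableU.
  by apply: measurableY => //; exact: mglue.
- by apply: measurableU; exact: measurableI.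
move=> x; rewrite !setY_def /glue /setD /setU /setI /=.
by case: (pselect (Z x)) => ?; tauto.
Qed.

(** Choose [Y n] missing less than [1/(n+1)] of [Z] and pool the countable families of all [Y n].
    For a given [e], half pays for [Z] outside a suitable [Y n], half for the approximation inside
    it. *)
Lemma separable_on_approx Z : measurable Z ->
  (forall e, (0 < e)%R -> exists Y, [/\ measurable Y, separable_on Y &
    mu (Z `\` Y) < e%:E]) ->
  separable_on Z.
Proof.
move=> mZ Zapprox.
have /choice[Y YP] (n : nat) : exists Y, [/\ measurable Y, separable_on Y &
    mu (Z `\` Y) < (n.+1%:R^-1)%:E].
  by apply: Zapprox; rewrite invr_gt0.
have /choice[D DP] (n : nat) := let: And3 _ sY _ := YP n in sY.
exists (\bigcup_n D n); split.
- by apply: bigcup_countable => // n _; have [] := DP n.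
- by move=> B [n _]; have [_ + _] := DP n; exact.
move=> A e mA e0; have e20 : (0 < e / 2)%R by rewrite divr_gt0.
have [n ne] : exists n : nat, (n.+1%:R^-1 < e / 2)%R.
  have [n _ /(_ n (leqnn _)) ne] := near_infty_natSinv_lt (PosNum e20).
  by exists n.
have [mY _ ZY] := YP n; have [_ mD /(_ A _ mA e20)[B DB AB]] := DP n.
exists B; first by exists n.
have mAB : measurable (A `+` B) by apply: measurableY => //; exact: mD.
have {}ZY : mu (Z `\` Y n) < (e / 2)%:E.
  by apply: lt_trans ZY _; rewrite lte_fin.
rewrite (splitr e) EFinD; apply: le_lt_trans (lteD AB ZY).
apply: (@le_trans _ _ (mu (((A `+` B) `&` Y n) `|` (Z `\` Y n)))); last first.
  by apply: measureU2; [exact: measurableI|exact: measurableD].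
apply: le_measure; rewrite ?inE.
- exact: measurableI.
- by apply: measurableU; [exact: measurableI|exact: measurableD].
move=> x [ABx Zx]; have [Yx|nYx] := pselect (Y n x); [by left|by right].
Qed.

End SeparableOn.

Lemma exists_pushforward d d' (T : measurableType d) (T' : measurableType d')
    (R : realType) (mu : {finite_measure set T -> \bar R}) (f : T -> T') :
  measurable_fun setT f ->
  exists nu : {finite_measure set T' -> \bar R},
    forall B, nu B = mu (f @^-1` B).
Proof.
move=> mf.
have [nu nuE] : exists nu : {measure set T' -> \bar R},
    forall B, nu B = mu (f @^-1` B).
  by unshelve eexists (pushforward mu f).
have fin_nu : fin_num_fun nu.
  move=> B mB; rewrite nuE; apply: fin_num_measure.
  by rewrite -[X in measurable X]setTI; exact: mf.
have sigma_fin_nu : sigma_finite setT nu.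
  by apply: fin_num_fun_sigma_finite => //; rewrite measure0.
(* The packed finite measure also carries the s-finite and sigma-finite structures, so all three are
   supplied. *)
pose nu1 := isFinite.Build _ _ _ _ fin_nu.
pose nu2 := isSFinite.Build _ _ _ _ (sfinite_measure_sigma_finite sigma_fin_nu).
pose nu3 := isSigmaFinite.Build _ _ _ _ sigma_fin_nu.
pose nu' := HB.pack_for {finite_measure set T' -> \bar R} (Measure.sort nu)
  nu1 nu2 nu3.
by exists nu'.
Qed.

(** * Regular Borel measures on a Hausdorff space *)

Section RegularMeasure.
Local Open Scope ereal_scope.
Context (X : ptopologicalType) (R : realType).
Hypothesis X_hausdorff : hausdorff_space X.

Lemma open_borel (U : set X) : open U -> measurable (U : set (borel X)).
Proof. exact: sub_gen_smallest. Qed.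

Lemma closed_borel (C : set X) : closed C -> measurable (C : set (borel X)).
Proof.
by move=> cC; rewrite -[C]setCK; apply: measurableC; apply: open_borel;
  exact: closed_openC.
Qed.

Lemma compact_borel (K : set X) : compact K -> measurable (K : set (borel X)).
Proof. by move=> cK; apply: closed_borel; exact: compact_closed. Qed.

(** For finite measures inner regularity implies outer regularity: a compact set nearly filling the
    complement of [B] is closed, so its own complement is an open set barely larger than [B]. *)
Lemma regular_measureP (mu : {finite_measure set (borel X) -> \bar R}) :
  regular_measure mu <->
  forall (B : set X) e, measurable (B : set (borel X)) -> (0 < e)%R ->
    exists K : set X, [/\ compact K, K `<=` B & mu (B `\` K) < e%:E].
Proof.
split=> [rmu B e mB e0|rmu B mB].
  have [supB _] := rmu B mB.
  have fB : ereal_sup [set mu K | K in [set K : set X | compact K /\ K `<=` B]]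
      \is a fin_num by rewrite -supB; exact: fin_num_measure.
  have [_ [K [cK KB] <-]] := ub_ereal_sup_adherent e0 fB.
  have mK := compact_borel cK.
  rewrite -supB => BK; exists K; split => //.
  rewrite measureD//; last by rewrite ltey_eq fin_num_measure.
  by rewrite (setIidr KB) lteBlDr ?fin_num_measure// addeC -lteBlDr.
have approx (A C : set X) : measurable (A : set (borel X)) ->
    measurable (C : set (borel X)) -> A `<=` C -> mu C = mu A + mu (C `\` A).
  move=> mA mC AC; rewrite -measureU//; last 2 first.
  - exact: measurableD.
  - by rewrite setDE setICA setICr setI0.
  by rewrite setDE setUIr setUCr setIT (setUidr AC).
split; apply/eqP; rewrite eq_le; apply/andP; split.
- apply/lee_addgt0Pr => e e0; have [K [cK KB BK]] := rmu B e mB e0.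
  rewrite (approx K B)//; last exact: compact_borel.
  by apply: leeD; [apply: ereal_sup_ubound; exists K|exact: ltW].
- apply: ge_ereal_sup => _ [K [cK KB] <-].
  by apply: le_measure; rewrite ?inE//; exact: compact_borel.
- apply: le_ereal_inf_tmp => _ [U [oU BU] <-].
  by apply: le_measure; rewrite ?inE//; exact: open_borel.
apply/lee_addgt0Pr => e e0; have [K [cK KB BK]] := rmu _ e (measurableC mB) e0.
have mK := compact_borel cK.
apply: (@le_trans _ _ (mu (~` K))).
  apply: ereal_inf_lbound; exists (~` K) => //; split.
    by apply: closed_openC; exact: compact_closed.
  by rewrite -[B]setCK; exact: subsetC.
rewrite (approx B (~` K)) //; last 2 first.
- exact: measurableC.
- by rewrite -[B]setCK; exact: subsetC.
by rewrite leeD2l// setDE setIC -setDE ltW.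
Qed.

(** A finite subcover reduces this to finite unions of open sets on which [mu] is separable. *)
Lemma compact_separable_on (mu : {finite_measure set (borel X) -> \bar R})
    (K : set X) : compact K ->
  (forall x, K x -> exists U : set X, [/\ open U, U x & separable_on mu U]) ->
  separable_on mu K.
Proof.
move=> cK sepK; move: (cK); rewrite compact_cover => coverK.
pose G := [set U : set X | open U /\ separable_on mu U].
have [U []//||F FG KF] := coverK _ G id.
  by move=> x /sepK[U [oU Ux sU]]; exists U.
have mG U : G U -> measurable (U : set (borel X)).
  by move=> [oU _]; exact: open_borel.
move: KF; set C := cover _ _ => KF.
(* Measurability is carried through the induction because [separable_onU] requires it of the partial
   unions. *)
have : measurable (C : set (borel X)) /\ separable_on mu C.
  rewrite /C /cover bigcup_fset; set s := finmap.enum_fset F.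
  have : {subset s <= G} by move=> U; exact: FG.
  elim: s => [|U s IH] sG.
    by rewrite big_nil; split; [exact: measurable0|exact: separable_on0].
  have [|ms ss] := IH; first by move=> V Vs; apply: sG; rewrite inE Vs orbT.
  have /sG/set_mem GU : U \in U :: s by rewrite mem_head.
  rewrite big_cons; split; first by apply: measurableU => //; exact: mG.
  by apply: separable_onU => //; [exact: mG|case: GU].
by move=> [mF sF]; apply: separable_onS sF => //; exact: compact_borel.
Qed.

End RegularMeasure.

Lemma injective_hausdorff (A X : topologicalType) (f : A -> X) :
  continuous f -> injective f -> hausdorff_space X -> hausdorff_space A.
Proof.
move=> f_cont f_inj hX x y xy; apply/f_inj/hX => U V fxU fyV.
have [a [Ua Va]] := xy _ _ (f_cont x _ fxU) (f_cont y _ fyV).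
by exists (f a).
Qed.

(** * Transfer of regular measures along an embedding of a compact space *)

Section Embedding.
Local Open Scope ereal_scope.
Context (A X : ptopologicalType) (R : realType) (f : A -> X).
Hypotheses (A_compact : compact [set: A]) (X_hausdorff : hausdorff_space X).
Hypotheses (f_cont : continuous f) (f_inj : injective f).

Let f_compact (K : set A) : compact K -> compact (f @` K).
Proof. by apply: continuous_compact; exact: continuous_subspaceT. Qed.

Let f_closed (C : set A) : closed C -> closed (f @` C).
Proof.
move=> cC; apply: compact_closed => //; apply: f_compact.
exact: subclosed_compact cC A_compact (@subsetT _ _).
Qed.

Let A_hausdorff : hausdorff_space A.
Proof. exact: injective_hausdorff f_cont f_inj X_hausdorff. Qed.

Let f_measurable : measurable_fun setT (f : borel A -> borel X).
Proof.
apply: (@measurability _ _ (borel A) (borel X) _ f (@open X)) => // _ [U oU <-].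
rewrite setTI; apply: open_borel.
by move/continuousP : f_cont; exact.
Qed.

(* Off [range f] the value is the junk [point], so that [r] is total and Borel. *)
Let r (x : X) : A := xget point (f @^-1` [set x]).

Let fK : cancel f r.
Proof.
move=> a; rewrite /r; case: xgetP => [b _ /f_inj //|/(_ a)]; by case.
Qed.

Let r_preimage (B : set A) : (r @^-1` B) `&` range f = f @` B.
Proof.
apply/seteqP; split=> [_ [/[swap] [[a _ <-]] /=]|_ [a Ba <-]].
  by rewrite fK => Ba; exists a.
by split; [rewrite /= fK|exists a].
Qed.

Let r_measurable : measurable_fun setT (r : borel X -> borel A).
Proof.
apply: (@measurability _ _ (borel X) (borel A) _ r (@open A)) => // _ [U oU <-].
rewrite setTI.
have mf : measurable (range f : set (borel X)).
  by apply: closed_borel; apply: f_closed; exact: closedT.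
rewrite -[r @^-1` U]setIT -(setvU (range f)) setIUr r_preimage.
apply: measurableU; last first.
  have -> : f @` U = range f `\` f @` (~` U).
    apply/seteqP; split=> [_ [a Ua <-]|_ [[a _ <-] nUa]].
      by split; [exists a|move=> [b + /f_inj ba]; rewrite ba].
    by exists a => //; apply: contrapT => Ua; apply: nUa; exists a.
  apply: measurableD => //; apply: closed_borel; apply: f_closed.
  exact: open_closedC.
have [rU|nrU] := pselect (U point).
  rewrite setIC (_ : _ `&` _ = ~` range f); first exact: measurableC.
  apply/setIidl => x nfx; rewrite /= /r; case: xgetP => // a _ fa.
  by exfalso; apply: nfx; exists a.
rewrite (_ : _ `&` _ = set0); first exact: measurable0.
rewrite -subset0 => x [+ nfx]; rewrite /= /r; case: xgetP => // a _ fa.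
by move=> _; apply: nfx; exists a.
Qed.

(** Restrict [mu] to [range f] and push it along [r]: the result gives [B] the mass [mu (f @] B)[.
    It is regular because compact subsets of]f @[B] pull back to compact subsets of [B]; images of
    its approximating sets then work for [mu]. *)
Lemma embedding_separable_on (mu : {finite_measure set (borel X) -> \bar R}) :
  (forall nu : {finite_measure set (borel A) -> \bar R},
    regular_measure nu -> separable_measure nu) ->
  regular_measure mu -> separable_on mu (range f).
Proof.
move=> sepA /(regular_measureP X_hausdorff) rmu.
have mf : measurable (range f : set (borel X)).
  by apply: closed_borel; apply: f_closed; exact: closedT.
have [nu nuE] := exists_pushforward (mrestr mu mf) r_measurable.
have {}nuE B : nu B = mu (f @` B) by rewrite nuE -(r_preimage B).
have mimage (B : set A) : measurable (B : set (borel A)) ->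
    measurable (f @` B : set (borel X)).
  move=> mB; rewrite -r_preimage; apply: measurableI => //.
  by rewrite -[X in measurable X]setTI; exact: r_measurable.
have mpreimage (B : set X) : measurable (B : set (borel X)) ->
    measurable (f @^-1` B : set (borel A)).
  by move=> mB; rewrite -[X in measurable X]setTI; exact: f_measurable.
have /sepA/separable_measureP[D [cD mD dD]] : regular_measure nu.
  apply/(regular_measureP A_hausdorff) => B e mB e0.
  have [K [cK KB BK]] := rmu _ e (mimage _ mB) e0.
  exists (f @^-1` K); split.
  - apply: subclosed_compact A_compact (@subsetT _ _).
    move/continuous_closedP : f_cont; apply; exact: compact_closed.
  - by move=> a /KB[b Bb /f_inj <-].
  rewrite nuE (_ : f @` _ = f @` B `\` K)//.
  apply/seteqP; split=> [_ [a [Ba nKa] <-]|_ [[a Ba <-] nKa]].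
    by split=> //; exists a.
  by exists a.
exists ((fun B => f @` B) @` D); split.
- exact: card_le_trans (card_image_le _ _) cD.
- by move=> _ [B /mD mB <-]; exact: mimage.
move=> B e mB e0; have [C DC BC] := dD _ _ (mpreimage _ mB) e0.
exists (f @` C); first by exists C.
move: BC; rewrite setIT nuE; congr (mu _ < _).
rewrite !setY_def; apply/seteqP; split.
  move=> _ [a [[Ba nCa]|[Ca nBa]] <-]; split; try by exists a.
    by left; split => // -[b Cb /f_inj ba]; apply: nCa; rewrite -ba.
  by right; split => //; exists a.
move=> _ [/[swap] [[a _ <-]] [[Ba nCa]|[[b Cb /f_inj ba] nBa]]]; exists a => //.
  by left; split => // Ca; apply: nCa; exists a.
by right; split => //; rewrite -ba.
Qed.

Lemma embedding_separable_measure
    (nu : {finite_measure set (borel A) -> \bar R}) :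
  (forall mu : {finite_measure set (borel X) -> \bar R},
    regular_measure mu -> separable_on mu (range f)) ->
  regular_measure nu -> separable_measure nu.
Proof.
move=> sepX /(regular_measureP A_hausdorff) rnu; apply/separable_measureP.
have [mu muE] := exists_pushforward nu f_measurable.
have mpreimage (B : set X) : measurable (B : set (borel X)) ->
    measurable (f @^-1` B : set (borel A)).
  by move=> mB; rewrite -[X in measurable X]setTI; exact: f_measurable.
have /sepX[D [cD mD dD]] : regular_measure mu.
  apply/(regular_measureP X_hausdorff) => B e mB e0.
  have [K [cK KB BK]] := rnu _ e (mpreimage _ mB) e0.
  exists (f @` K); split; first exact: f_compact.
    by move=> _ [a /KB + <-].
  rewrite muE (_ : f @^-1` _ = f @^-1` B `\` K)//.
  apply/seteqP; split=> [a []|a [Bfa nKa]]; split => //.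
  by move=> [b Kb /f_inj ba]; apply: nKa; rewrite -ba.
exists ((fun B => f @^-1` B) @` D); split.
- exact: card_le_trans (card_image_le _ _) cD.
- by move=> _ [B /mD mB <-]; exact: mpreimage.
move=> B e mB e0.
have mrB : measurable (r @^-1` B : set (borel X)).
  by rewrite -[X in measurable X]setTI; exact: r_measurable.
have [C DC BC] := dD _ _ mrB e0.
exists (f @^-1` C); first by exists C.
move: BC; rewrite muE; congr (nu _ < _).
apply/seteqP; rewrite !setY_def.
by split=> a; rewrite /setU /setD /setI /= fK;
  [move=> [? _]|move=> [? _]; split => //; exists a].
Qed.

End Embedding.

(** * Closed subspaces, and [MS] expressed by measures on the ambient space *)

Lemma set_type_compact (X : topologicalType) (Z : set X) :
  compact [set: X] -> closed Z -> compact [set: Z].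
Proof.
move=> cX closedZ F FF _.
have cZ := subclosed_compact closedZ cX (@subsetT _ _).
have [|x [Zx Fx]] := cZ (set_val @ F) _.
  by apply: (@filterS _ F _ setT) => [z _|]; [exact: set_valP|exact: filterT].
exists (exist _ x (mem_set Zx)); split=> // U V FU [W [[W' oW' <-] /= W'x WV]].
have nW' := open_nbhs_nbhs (conj oW' W'x).
have [|_ [[z Uz <-] W'z]] := Fx (set_val @` U) W' _ nW'.
  by apply: (@filterS _ F _ U) => // z Uz; exists z.
by exists z; split => //; exact: WV.
Qed.

Lemma set_val_continuous (X : topologicalType) (Z : set X) :
  continuous (set_val : Z -> X).
Proof. exact: initial_continuous. Qed.

Lemma range_set_val (X : Type) (Z : set X) : range (set_val : Z -> X) = Z.
Proof.
apply/seteqP; split=> [_ [z _ <-]|x Zx]; first exact: set_valP.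
by exists (exist _ x (mem_set Zx)).
Qed.

Section MSEmbedding.
Context (A X : topologicalType) (R : realType) (f : A -> X).
Hypotheses (A_compact : compact [set: A]) (X_hausdorff : hausdorff_space X).
Hypotheses (f_cont : continuous f) (f_inj : injective f).

(** Subspaces, and subspaces of subspaces, can thus be compared through their images in the single
    space [X]. *)
Lemma embedding_MSP : MS R A <->
  forall (x : X) (mu : {finite_measure set (borel (pointed_at x)) -> \bar R}),
    regular_measure mu -> separable_on mu (range f).
Proof.
split=> [[_ _ sepA] x mu rmu|sepX].
  (* The transfer lemma needs a base point in [A]; if [A] is empty, so is the range, where
     separability is trivial. *)
  have [[_ [a _ _]]|noA] := pselect (range f !=set0).
    apply: (@embedding_separable_on (pointed_at a) (pointed_at x)) => //.
    exact: sepA.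
  by rewrite (_ : range f = set0); [exact: separable_on0|exact/nonemptyPn].
split=> //; first exact: injective_hausdorff X_hausdorff.
move=> a nu.
apply: (@embedding_separable_measure (pointed_at a) (pointed_at (f a)) R f) => //.
exact: sepX.
Qed.

End MSEmbedding.

(** * The four properties of the kernel *)

Section Kernel.
Context (R : realType) (X : topologicalType).
Hypotheses (X_compact : compact [set: X]) (X_hausdorff : hausdorff_space X).

Lemma closed_MSP (Z : set X) : closed Z -> MS R Z <->
  forall (x : X) (mu : {finite_measure set (borel (pointed_at x)) -> \bar R}),
    regular_measure mu -> separable_on mu Z.
Proof.
move=> cZ; have := @embedding_MSP Z X R set_val.
rewrite range_set_val; apply=> //.
- exact: set_type_compact.
- exact: set_val_continuous.
Qed.

Lemma MS_embed (A : topologicalType) (f : A -> X) (Z : set X) :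
  compact [set: A] -> continuous f -> injective f -> closed Z ->
  range f `<=` Z -> MS R Z -> MS R A.
Proof.
move=> cA cf f_inj cZ fZ /(closed_MSP cZ) sepZ.
apply/(embedding_MSP R cA X_hausdorff cf f_inj) => x mu rmu.
apply: (@separable_onS _ _ _ mu (range f) Z) => //; last exact: sepZ rmu.
  apply: (@compact_borel (pointed_at x)) => //; apply: continuous_compact => //.
  exact: continuous_subspaceT.
exact: (@closed_borel (pointed_at x)).
Qed.

Lemma separable_on_nker x
    (mu : {finite_measure set (borel (pointed_at x)) -> \bar R}) :
  regular_measure mu ->
  forall y, ~ ker R X y -> exists U : set X, [/\ open U, U y & separable_on mu U].
Proof.
move=> rmu y /contrapT[U [oU /closed_MSP-/(_ (@closed_closure _ _))sepU] Uy].
exists U; split=> //; apply: (@separable_onS _ _ _ mu U (closure U)).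
- exact: (@open_borel (pointed_at x)).
- by apply: (@closed_borel (pointed_at x)); exact: closed_closure.
- exact: subset_closure.
- exact: sepU.
Qed.

Lemma closed_ker : closed (ker R X).
Proof. by apply: open_closedC; apply: bigcup_open => U []. Qed.

(** If [U] is open with closure in [MS], the closure in [Y] of its trace embeds into [closure U],
    hence is in [MS] as well. *)
Lemma ker_closed_sub (Y : set X) : closed Y -> set_val @` ker R Y `<=` ker R X.
Proof.
move=> cY _ [y kery <-] [U [oU MSU] Uy]; apply: kery.
have cval := @set_val_continuous _ Y.
exists (set_val @^-1` U) => //; split; first by move/continuousP : cval; exact.
set V := _ @^-1` U.
apply: (@MS_embed (closure V) (set_val \o set_val) (closure U)) => //.
- by apply: set_type_compact; [exact: set_type_compact|exact: closed_closure].
- move=> v; apply: continuous_comp; [exact: set_val_continuous|exact: cval].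
- by apply: inj_comp; exact: val_inj.
- exact: closed_closure.
move=> _ [v _ <-] W /cval/(set_valP v)[z [Uz Wz]].
by exists (set_val z).
Qed.

Lemma MS_ker0 : MS R X <-> ker R X = set0.
Proof.
split=> [MSX|ker0].
  (* The whole space is an open set whose closure is in [MS]. *)
  rewrite -subset0 => x; apply; exists setT => //; split; first exact: openT.
  rewrite closureT; apply/(closed_MSP closedT) => y mu rmu.
  have [_ _ sepX] := MSX; exact/separable_measureP/sepX.
have id_cont : continuous (@id X) by move=> x.
apply/(embedding_MSP R X_compact X_hausdorff id_cont (@inj_id X)) => x mu rmu.
rewrite image_id.
apply: (@compact_separable_on (pointed_at x)) => // y _.
by apply: separable_on_nker => //; rewrite ker0.
Qed.

Lemma ker_ker : set_val @` ker R (ker R X) = ker R X.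
Proof.
apply/seteqP; split=> [_ [y _ <-]|x kerx]; first exact: set_valP.
exists (exist _ x (mem_set kerx)) => // -[_ [[V oV <-] MSV] Vx].
have {}Vx : V x := Vx.
(* [W] comes from regularity of compact Hausdorff spaces. It is only a neighbourhood, so its
   interior is the open set used against [kerx]. *)
have [W Wx WV] : filter_from (nbhs x) closure V.
  apply: (compact_regular X_hausdorff X_compact) => //; first exact: filterT.
  exact: open_nbhs_nbhs.
apply: kerx; exists (W°); last exact: Wx.
split; first exact: open_interior.
have cK := closed_ker; set K := ker R X in cK *.
have clWV : closure (W°) `<=` V.
  by move=> y /(closureS (@interior_subset _ _))/WV.
apply/(closed_MSP (@closed_closure _ _)) => y mu rmu.
have mcl : measurable (closure (W°) : set (borel (pointed_at y))).
  by apply: closed_borel; exact: closed_closure.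
have mK : measurable (K : set (borel (pointed_at y))) by exact: closed_borel.
(* The trace on [K] lies in [V], hence in the image of [VK], which is a subspace of a subspace: [f]
   composes the two inclusions. *)
have sepWK : separable_on mu (closure (W°) `&` K).
  set VK := closure _ in MSV; pose f : VK -> X := set_val \o set_val.
  have cf : continuous f.
    by move=> v; apply: continuous_comp; exact: set_val_continuous.
  have cVK : compact [set: VK].
    by apply: set_type_compact; [exact: set_type_compact|exact: closed_closure].
  have f_inj : injective f by apply: inj_comp; exact: val_inj.
  have sepf := (embedding_MSP R cVK X_hausdorff cf f_inj).1 MSV y mu rmu.
  apply: separable_onS sepf.
  - exact: measurableI.
  - apply: (@compact_borel (pointed_at y)) => //; apply: continuous_compact => //.
    exact: continuous_subspaceT.
  move=> z [/clWV Vz Kz]; pose k : K := exist _ z (mem_set Kz).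
  have kV : VK k by exact: subset_closure.
  by exists (exist _ k (mem_set kV)).
have /regular_measureP-/(_ X_hausdorff) approx := rmu.
(* The rest of [closure (W°)] lies off [K]; inner regularity of the complement of [K] gives a
   compact [C] that misses less than [e] of it. *)
apply: separable_on_approx => // e e0.
have [C [cC CK KC]] := approx _ e (measurableC mK) e0.
have mC : measurable (C : set (borel (pointed_at y))) by exact: compact_borel.
exists ((closure (W°) `&` K) `|` C); split.
- by apply: measurableU => //; exact: measurableI.
- apply: separable_onU => //; first exact: measurableI.
  (* Each point of [C] is outside the kernel, so [mu] is separable on a neighbourhood of it. *)
  apply: (@compact_separable_on (pointed_at y)) => // z /CK.
  exact: separable_on_nker.
apply: le_lt_trans KC; apply: le_measure; rewrite ?inE.
- by apply: measurableD => //; apply: measurableU => //; exact: measurableI.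
- by apply: measurableD => //; exact: measurableC.
move=> z [clz nz]; split; last by move=> Cz; apply: nz; right.
by move=> Kz; apply: nz; left.
Qed.

End Kernel.

Theorem theorem2p8 (R : realType) (X : topologicalType)
    (X_compact : compact [set: X]) (X_hausdorff : hausdorff_space X) :
  [/\ closed (ker R X),
      forall Y : set X, closed Y -> set_val @` ker R Y `<=` ker R X,
      MS R X <-> ker R X = set0
    & set_val @` ker R (ker R X) = ker R X].
Proof.
split; [exact: closed_ker|exact: ker_closed_sub|exact: MS_ker0|exact: ker_ker].
Qed.
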